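(* Let $G=(V,E)$ be a finite graph with at least one circuit, let $N\ge1$, and let $W_1,W_2:\mathbb{N}\to(0,\infty)$. Consider the Ant random walk on $G$ with $N$ walkers and reinforcement functions $W_1,W_2$. Assume that $W_1\in\mathcal{P}_{\le}$, that $W_2\in\mathcal{P}_{\ge}$, that there exists a constant $C=C(W_2)$ such that for all integers $M$ with $-N\le M\le N$ and all $n\in\mathbb{N}$ with $n+M\ge0$ one has $W_2(n+M)\le C\,W_2(n)$, and that $\sum_{k=0}^\infty \frac{W_2(k)}{W_1(k)}=\infty$. Then $$\mathbb{P}(\mathrm{Monot})=0.$$
   Context: $\mathbb{N}=\{0,1,2,\dots\}$, $[N]=\{1,\dots,N\}$. All graphs are undirected, connected, without loops and without parallel edges; $u\sim v$ means $\{u,v\}\in E$; $\vec E=\{(u,v):\{u,v\}\in E\}$ is the set of oriented edges. A circuit of $G$ is a simple cycle of length at least $3$ (so ''at least one circuit'' means $G$ is not a tree). Ant random walk. Given $W_1,W_2:\mathbb{N}\to(0,\infty)$, define $W:\mathbb{Z}\to(0,\infty)$ by $W(k)=W_1(k)$ for $k>0$ and $W(k)=W_2(-k)$ for $k\le0$. The process $\vec X(n)=(X_1(n),\dots,X_N(n))\in V^N$, $n\in\mathbb{N}$, starts from an arbitrary fixed distribution of $\vec X(0)$. The crossing number of $(u,v)\in\vec E$ at time $n$ is $$c_n(u,v)=\sum_{i=1}^N\sum_{m=1}^n\big(\mathbf 1_{[(X_i(m-1),X_i(m))=(u,v)]}-\mathbf 1_{[(X_i(m-1),X_i(m))=(v,u)]}\big),$$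 so $c_0\equiv0$. At each time $n\ge1$ an index $i\in[N]$ is chosen uniformly at random, independently of the past; all walkers other than $X_i$ stay put, and, conditionally on the past up to time $n-1$, $X_i(n)=u$ for $u\sim X_i(n-1)$ with probability $$\frac{W(c_{n-1}(X_i(n-1),u))}{\sum_{w\sim X_i(n-1)}W(c_{n-1}(X_i(n-1),w))}.$$ $\mathcal{P}_{\le}$ is the class of functions $f:\mathbb{N}\to(0,\infty)$ such that for every $i\in\mathbb{N}$ there is a constant $C_i=C_i(f)\in\mathbb{R}_+$ with $\sum_{j=1}^if(a_j)\le C_i f\big(\sum_{j=1}^ia_j\big)$ for all $(a_1,\dots,a_i)\in\mathbb{N}^i$. $\mathcal{P}_{\ge}$ is the class of $f:\mathbb{N}\to(0,\infty)$ satisfying the analogous lower bound: for every $i$ (with $i\geq 1$) there is a constant $C_i=C_i(f)>0$ with $\sum_{j=1}^if(a_j)\ge C_i f\big(\sum_{j=1}^ia_j\big)$ for all $(a_1,\dots,a_i)\in\mathbb{N}^i$. $\mathrm{Monot}$ is the event that there exists $m\in\mathbb{N}$ such that for every $(u,v)\in\vec E$ the map $n\mapsto c_n(u,v)$, $n\ge m$, is monotone. *)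

(* Defs.v *)
From HB Require Import structures.
From mathcomp Require Import all_boot all_order all_algebra.
From mathcomp Require Import all_classical all_reals all_analysis.

Set Implicit Arguments.
Unset Strict Implicit.
Unset Printing Implicit Defensive.

Import Order.TTheory GRing.Theory Num.Theory.
Import numFieldNormedType.Exports.

Local Open Scope classical_set_scope.
Local Open Scope ring_scope.

Record connected_simple_graph (V : finType) (e : rel V) : Prop := {
  graph_sym : symmetric e;
  graph_irrefl : irreflexive e;
  graph_connected : forall u v : V, connect e u v
}.

Definition has_circuit (V : finType) (e : rel V) : Prop :=
  exists2 p : seq V, (3 <= size p)%N & ucycle e p.

Definition class_Ple (R : realType) (f : nat -> R) : Prop :=
  forall i : nat, exists2 C : R, 0 <= C &
    forall a : 'I_i -> nat, \sum_(j < i) f (a j) <= C * f (\sum_(j < i) a j)%N.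

(* For i = 0 the sum on the left is empty, so no C > 0 could work. *)
Definition class_Pge (R : realType) (f : nat -> R) : Prop :=
  forall i : nat, (1 <= i)%N -> exists2 C : R, 0 < C &
    forall a : 'I_i -> nat, C * f (\sum_(j < i) a j)%N <= \sum_(j < i) f (a j).

Definition weight (R : realType) (W1 W2 : nat -> R) (k : int) : R :=
  if 0 < k then W1 `|k|%N else W2 `|k|%N.

Definition config (V : finType) (N : nat) := {ffun 'I_N -> V}.

(* c_n(u,v) along the deterministic trajectory x; it only depends on
   x 0, ..., x n. *)
Definition crossing (V : finType) (N : nat) (x : nat -> config V N)
    (n : nat) (u v : V) : int :=
  \sum_(i < N) \sum_(1 <= m < n.+1)
    (((x m.-1 i, x m i) == (u, v))%:Z - ((x m.-1 i, x m i) == (v, u))%:Z).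

Definition past (T : Type) (V : finType) (N : nat)
    (X : nat -> T -> config V N) (n : nat) (x : nat -> config V N) : set T :=
  [set w | forall m, (m <= n)%N -> X m w = x m].

(* V^N and [N] are finite, so measurability and conditioning are expressed
   through the events "X m = x m for all m <= n".  S n is the index chosen at
   time n >= 1 (S 0 is unused); the law of X 0 is unconstrained.  Conditional
   probabilities are written in product form P(A & B) = p * P(A), so that null
   pasts impose nothing.  The past records positions only: G has no loops, so
   the selected walker a.s. moves and past indices are a.s. functions of the
   positions. *)
Record ant_random_walk (R : realType) (V : finType) (e : rel V) (N : nat)
    (W1 W2 : nat -> R) (d : measure_display) (T : measurableType d)
    (P : probability T R) (X : nat -> T -> config V N)
    (S : nat -> T -> 'I_N) : Prop := {
  arw_measurable_pos : forall n x, measurable [set w | X n w = x];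
  arw_measurable_sel : forall n i, measurable [set w | S n w = i];
  arw_select : forall n (x : nat -> config V N) (i : 'I_N),
    P (past X n x `&` [set w | S n.+1 w = i]) =
      ((N%:R)^-1%:E * P (past X n x))%E;
  arw_stay : forall n,
    {ae P, forall w, forall j : 'I_N, j != S n.+1 w -> X n.+1 w j = X n w j};
  arw_move : forall n (x : nat -> config V N) (i : 'I_N) (u : V),
    e (x n i) u ->
    P (past X n x `&` [set w | S n.+1 w = i] `&` [set w | X n.+1 w i = u]) =
      ((weight W1 W2 (crossing x n (x n i) u) /
        \sum_(v | e (x n i) v) weight W1 W2 (crossing x n (x n i) v))%:E *
       P (past X n x `&` [set w | S n.+1 w = i]))%E
}.

Definition monotone_seq (c : nat -> int) : Prop :=
  nondecreasing_seq c \/ nonincreasing_seq c.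

Definition Monot (T : Type) (V : finType) (e : rel V) (N : nat)
    (X : nat -> T -> config V N) : set T :=
  [set w | exists m : nat, forall u v : V, e u v ->
    monotone_seq (fun n => crossing (X ^~ w) (m + n) u v)].

(* Main.v *)
(* On Monot, from some time m on every edge is either never used again or is
   crossed in a single direction with crossing number tending to infinity.
   Pick a vertex v left through an edge of the latter kind.  The signed crossing
   numbers out of v sum to at most N in absolute value, so some edge at v is used
   inwards only.  With K the sum of the positive c(v,u), the sum of the |c(v,u)|
   over the other edges is K up to N, and the hypotheses on W1 and W2 show that a
   walker leaving v takes an edge with c(v,u) > 0 with probability at most
   1 / (1 + c W2(K) / W1(K)).  Each such departure raises K by 1 and nothing else
   changes K, so phi(K) with phi(k) = 1 + c (sum of W2(j)/W1(j) over j < k) is a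
   supermartingale as long as monotonicity is not violated.  Hence K reaches L
   without violation with probability O(1 / phi(L)), which tends to 0, whereas on
   Monot K is unbounded. *)
Require Import Defs.
From HB Require Import structures.
From mathcomp Require Import all_boot all_order all_algebra.
From mathcomp Require Import all_classical all_reals all_analysis.
From mathcomp Require Import zify ring lra.

Set Implicit Arguments.
Unset Strict Implicit.
Unset Printing Implicit Defensive.

Import Order.TTheory GRing.Theory Num.Theory.
Import numFieldNormedType.Exports.

Local Open Scope classical_set_scope.
Local Open Scope ring_scope.

(** * Crossing numbers and flow through a vertex along a fixed trajectory *)

Section Crossing.
Variables (V : finType) (e : rel V) (N : nat).
Hypothesis Ggraph : connected_simple_graph e.
Implicit Types (x y : nat -> config V N) (u v : V) (n m : nat) (i : 'I_N).

(** Pathwise shape of one step. The walk has it only almost surely, so the combinatorial lemmas take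
    it as a hypothesis on the trajectory. *)
Definition legit x n : Prop := exists i u,
  [/\ e (x n i) u, x n.+1 i = u & forall j, j != i -> x n.+1 j = x n j].

Lemma crossing_eq x y n : (forall m, (m <= n)%N -> x m = y m) ->
  crossing x n = crossing y n.
Proof.
move=> xy; apply/funext => u; apply/funext => v; apply: eq_bigr => i _.
apply: eq_big_nat => m /andP[m0 mn].
rewrite (xy m.-1) ?(xy m) //; lia.
Qed.

Lemma crossingS x n u v :
  crossing x n.+1 u v = crossing x n u v +
  \sum_(i < N) (((x n i, x n.+1 i) == (u, v))%:Z -
                ((x n i, x n.+1 i) == (v, u))%:Z).
Proof.
rewrite /crossing -big_split /=; apply: eq_bigr => i _.
by rewrite big_nat_recr.
Qed.

Lemma crossing_legit x n i u a b : a != b -> x n.+1 i = u ->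
  (forall j, j != i -> x n.+1 j = x n j) ->
  crossing x n.+1 a b = crossing x n a b +
    (((x n i, u) == (a, b))%:Z - ((x n i, u) == (b, a))%:Z).
Proof.
move=> ab xi xj; rewrite crossingS (bigD1 i)//= big1 ?addr0 ?xi// => j ji.
rewrite xj// !xpair_eqE.
have -> : (x n j == a) && (x n j == b) = false.
  by apply/negP => /andP[/eqP-> /eqP abE]; rewrite abE eqxx in ab.
have -> // : (x n j == b) && (x n j == a) = false.
by apply/negP => /andP[/eqP-> /eqP abE]; rewrite abE eqxx in ab.
Qed.

Lemma edge_neq u v : e u v -> u != v.
Proof. by apply: contraTneq => ->; rewrite (graph_irrefl Ggraph). Qed.

Definition netflow x n v : int := \sum_(u | e v u) crossing x n v u.

(** Conservation at a vertex: a departure from [v] raises the net flow by 1 and an arrival lowers it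
    by 1, so the flow telescopes to the loss of walkers at [v]. Both occupation numbers lie between
    0 and [N], whence [netflow_bound]. *)
Lemma netflow_occupation x n v : (forall k, (k < n)%N -> legit x k) ->
  netflow x n v =
  \sum_(i < N) (x 0%N i == v)%:Z - \sum_(i < N) (x n i == v)%:Z.
Proof.
elim: n => [_|n IH leg].
  rewrite subrr; apply: big1 => u _; rewrite /crossing big1// => i _.
  by rewrite big_nil.
have [i [u [eiu xi xj]]] := leg n (ltnSn n).
rewrite /netflow.
rewrite (eq_bigr (fun w => crossing x n v w +
    (((x n i, u) == (v, w))%:Z - ((x n i, u) == (w, v))%:Z))); last first.
  by move=> w evw; apply: crossing_legit => //; apply: edge_neq.
rewrite big_split /= -/(netflow _ _ _) IH; last by move=> k kn; apply: leg; lia.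
rewrite sumrB.
rewrite (bigD1 (P := fun=> true) (F := fun j => (x n j == v)%:Z) i)//=.
rewrite (bigD1 (P := fun=> true) (F := fun j => (x n.+1 j == v)%:Z) i)//=.
rewrite (eq_bigr (F1 := fun j => (x n.+1 j == v)%:Z)
  (fun j => (x n j == v)%:Z)); last by move=> j ji; rewrite xj.
rewrite xi.
(* Only one neighbour can contribute to each of the two sums: the target [u] of a departure here,
   and the origin [x n i] of an arrival below, which is a neighbour of [v] by symmetry. *)
have -> : \sum_(w | e v w) ((x n i, u) == (v, w))%:Z = (x n i == v)%:Z.
  case: (eqVneq (x n i) v) => [<-|ne].
    rewrite (bigD1 u)//= eqxx big1 ?addr0// => w /andP[_ wu].
    by rewrite xpair_eqE eqxx /= eq_sym (negbTE wu).
  by rewrite big1// => w _; rewrite xpair_eqE (negbTE ne).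
have -> : \sum_(w | e v w) ((x n i, u) == (w, v))%:Z = (u == v)%:Z.
  case: (eqVneq u v) => [<-|ne].
    rewrite (bigD1 (x n i))/=; last by rewrite (graph_sym Ggraph).
    rewrite eqxx big1 ?addr0// => w /andP[_ wu].
    by rewrite xpair_eqE eqxx andbT eq_sym (negbTE wu).
  by rewrite big1// => w _; rewrite xpair_eqE (negbTE ne) andbF.
ring.
Qed.

Lemma sum_bool_le (A : 'I_N -> bool) :
  0 <= \sum_(i < N) (A i)%:Z <= N%:Z.
Proof.
apply/andP; split; first by apply: sumr_ge0.
apply: (@le_trans _ _ (\sum_(i < N) 1%:Z)); last first.
  by rewrite sumr_const card_ord natz.
by apply: ler_sum => i _; case: (A i).
Qed.

Lemma netflow_bound x n v : (forall k, (k < n)%N -> legit x k) ->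
  - N%:Z <= netflow x n v <= N%:Z.
Proof.
move/netflow_occupation ->.
have := sum_bool_le (fun i => x 0%N i == v).
have := sum_bool_le (fun i => x n i == v).
lia.
Qed.

Definition outflow x n v : nat :=
  (\sum_(u | e v u && (0 < crossing x n v u)%R) `|crossing x n v u|)%N.

(** Crossing number 0 falls on this side, as in [weight]: it adds nothing here, but its edge still
    carries weight [W2 0]. *)
Definition inflow x n v : nat :=
  (\sum_(u | e v u && ~~ (0 < crossing x n v u)%R) `|crossing x n v u|)%N.

Lemma outflow_inflow x n v :
  (outflow x n v)%:Z = (inflow x n v)%:Z + netflow x n v.
Proof.
rewrite /netflow (bigID (fun u => 0 < crossing x n v u)) /= /outflow /inflow.
rewrite addrCA -[LHS]addr0 -!natz !natr_sum -big_split/=; congr (_ + _).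
  by apply: eq_bigr => u /andP[_ c0]; rewrite natz; lia.
apply/esym; apply: big1 => u /andP[_ c0]; rewrite natz; lia.
Qed.

Lemma outflow_eq x y n v : (forall m, (m <= n)%N -> x m = y m) ->
  outflow x n v = outflow y n v.
Proof. by move=> xy; rewrite /outflow (crossing_eq xy). Qed.

(** What the drift estimate needs from the history. The witness [w] makes the set of edges weighted
    by [W2] nonempty, as [class_Pge] requires. *)
Definition balanced v x n : Prop := - N%:Z <= netflow x n v <= N%:Z /\
  exists2 w, e v w & crossing x n v w <= 0.

(* Step [n] is legit and does not violate monotonicity at [v], given that every
   crossing number at [v] has settled. *)
Definition good v x n : Prop := balanced v x n /\ exists i u,
  [/\ e (x n i) u, x n.+1 i = u, forall j, j != i -> x n.+1 j = x n j,
      x n i = v -> 0 < crossing x n v u & u = v -> crossing x n v (x n i) < 0].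

Lemma balanced_eq v x y n : (forall m, (m <= n)%N -> x m = y m) ->
  balanced v x n -> balanced v y n.
Proof. by move=> xy; rewrite /balanced /netflow (crossing_eq xy). Qed.

Lemma good_eq v x y n : (forall m, (m <= n.+1)%N -> x m = y m) ->
  good v x n -> good v y n.
Proof.
move=> xy [bx [i [u gd]]].
have xy' m : (m <= n)%N -> x m = y m by move=> mn; apply: xy; lia.
split; first exact: balanced_eq bx.
by exists i, u; rewrite -(crossing_eq xy') -xy// -xy.
Qed.

(** A departure uses an edge that is already positive, and an arrival makes a negative edge more
    negative. No edge at [v] changes side, so both outflows sum over the same edges and only a
    departure adds 1. *)
Lemma outflow_step v x n i u : e (x n i) u -> x n.+1 i = u ->
  (forall j, j != i -> x n.+1 j = x n j) ->
  (x n i = v -> 0 < crossing x n v u) ->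
  (u = v -> crossing x n v (x n i) < 0) ->
  outflow x n.+1 v = (outflow x n v + (x n i == v))%N.
Proof.
move=> eiu xi xj dep ent.
have cE w : e v w -> crossing x n.+1 v w = crossing x n v w +
    (((x n i, u) == (v, w))%:Z - ((x n i, u) == (w, v))%:Z).
  by move=> evw; apply: crossing_legit => //; apply: edge_neq.
have nu := edge_neq eiu.
have cS w : e v w -> (0 < crossing x n.+1 v w) = (0 < crossing x n v w).
  move=> evw; rewrite cE// !xpair_eqE.
  case: (eqVneq (x n i) v) => [iv|iv].
    have -> : u == v = false by apply/negbTE; rewrite -iv eq_sym.
    case: (eqVneq u w) => [uw|]; last by rewrite ?andbF; lia.
    have := dep iv; rewrite uw; lia.
  case: (eqVneq u v) => [uv|]; last by rewrite ?andbF; lia.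
  case: (eqVneq (x n i) w) => [iw|]; last by rewrite ?andbF; lia.
  have := ent uv; rewrite iw; lia.
rewrite /outflow (eq_bigl (fun w => e v w && (0 < crossing x n v w))); last first.
  by move=> w; case: (boolP (e v w)) => //= evw; rewrite cS.
have eqb : forall w, e v w && (0 < crossing x n v w) ->
  `|crossing x n.+1 v w|%N =
  (`|crossing x n v w| + ((x n i, u) == (v, w)))%N.
  move=> w /andP[evw cp]; rewrite cE//.
  have -> : (x n i, u) == (w, v) = false.
    apply/negP => /eqP[iw uv]; have := ent uv; rewrite iw; lia.
  lia.
rewrite (eq_bigr _ eqb) big_split/=; congr addn.
case: (eqVneq (x n i) v) => [iv|ne].
  rewrite (bigD1 u)/=; last by rewrite -{1}iv eiu dep.
  rewrite iv eqxx big1// => w /andP[_ wu].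
  by rewrite xpair_eqE eqxx /= eq_sym (negbTE wu).
by rewrite big1// => w _; rewrite xpair_eqE (negbTE ne).
Qed.

Lemma good_outflow_le v x n : good v x n -> (outflow x n v <= outflow x n.+1 v)%N.
Proof.
by move=> [_ [i [u [eiu xi xj dep ent]]]]; rewrite (outflow_step eiu xi xj dep ent) leq_addr.
Qed.

End Crossing.

(** * Monotone integer sequences: eventually constant or divergent *)

Lemma bounded_nondecreasing_int (b : nat) (c : nat -> int) :
  nondecreasing_seq c -> (forall n, c n <= c 0%N + b%:Z) ->
  exists m, forall n, (m <= n)%N -> c n = c m.
Proof.
elim: b c => [|b IH] c ci cb.
  exists 0%N => n _; have := ci _ _ (leq0n n); have := cb n; lia.
have [allc|/existsNP[p cp]] := pselect (forall n, c n = c 0%N).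
  by exists 0%N => n _.
(* By integrality a change is a rise of at least 1, so the sequence started at [p] has room at most
   [b] left. *)
have c0p : c 0%N + 1 <= c p by have := ci _ _ (leq0n p); lia.
have [n k|n|m mP] := IH (fun n => c (p + n)%N).
- by move=> nk; apply: ci; lia.
- by rewrite addn0; have := cb (p + n)%N; lia.
exists (p + m)%N => n mn; have -> : n = (p + (n - p))%N by lia.
apply: mP; lia.
Qed.

Definition increasing_from (c : nat -> int) m : Prop :=
  [/\ forall n, (m <= n)%N -> 0 < c n,
      forall n p, (m <= n)%N -> (n <= p)%N -> c n <= c p &
      forall L, exists2 n, (m <= n)%N & L <= c n].

Definition settled_from (c : nat -> int) m : Prop :=
  [\/ forall n, (m <= n)%N -> c n = c m,
      increasing_from c m |
      increasing_from (fun n => - c n) m].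

Lemma settled_from_leq c m m' : (m <= m')%N ->
  settled_from c m -> settled_from c m'.
Proof.
have incr c' : (m <= m')%N -> increasing_from c' m -> increasing_from c' m'.
  move=> mm' [pos mono unb]; split=> [n m'n|n p m'n np|L].
  - by apply: pos; lia.
  - by apply: mono => //; lia.
  - have [n mn Ln] := unb L; exists (maxn n m'); first by lia.
    by apply: le_trans Ln _; apply: mono => //; lia.
move=> mm' [cst|/incr ip|/incr im].
- by constructor 1 => n m'n; rewrite !cst //; lia.
- by constructor 2; apply: ip.
- by constructor 3; apply: im.
Qed.

(** A bounded sequence stabilises by integrality; an unbounded one is positive from the first time
    it is seen to reach 1. *)
Lemma nondecreasing_settled (c : nat -> int) m :
  nondecreasing_seq (fun n => c (m + n)%N) ->
  exists m', (forall n, (m' <= n)%N -> c n = c m') \/ increasing_from c m'.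
Proof.
move=> ci.
have [[b cb]|unb] := pselect (exists b : int, forall n, c (m + n)%N <= b).
  have [n|m' m'P] := bounded_nondecreasing_int (b := `|b - c m|) ci.
    by rewrite addn0; have := cb n; have := cb 0%N; rewrite addn0; lia.
  exists (m + m')%N; left => n mn; have -> : n = (m + (n - m))%N by lia.
  by apply: m'P; lia.
have unb' L : exists n, L <= c (m + n)%N.
  apply: contra_notP unb => noL; exists L => n.
  by case: (leP (c (m + n)%N) L) => // Lc; case: noL; exists n; lia.
have mono n p : (m <= n)%N -> (n <= p)%N -> c n <= c p.
  move=> mn np; have -> : n = (m + (n - m))%N by lia.
  have -> : p = (m + (p - m))%N by lia.
  by apply: ci; lia.
have [p cp] := unb' 1; exists (m + p)%N; right; split.
- by move=> n mn; have := mono (m + p)%N n; lia.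
- by move=> n q mn nq; apply: mono => //; lia.
- move=> L; have [n Ln] := unb' L; exists (m + maxn n p)%N; first by lia.
  by apply: le_trans Ln _; apply: mono; lia.
Qed.

Lemma monotone_settled (c : nat -> int) m :
  monotone_seq (fun n => c (m + n)%N) -> exists m', settled_from c m'.
Proof.
case=> [/nondecreasing_settled|cd].
  by case=> m' [cst|inc]; exists m'; [constructor 1|constructor 2].
have [|m' [cst|inc]] := @nondecreasing_settled (fun n => - c n) m.
- by move=> n p np; rewrite lerN2; apply: cd.
- by exists m'; constructor 1 => n /cst /oppr_inj.
- by exists m'; constructor 3.
Qed.

Lemma eventually_forall_fin (I : finType) (Q : I -> nat -> Prop) :
  (forall i m m', (m <= m')%N -> Q i m -> Q i m') ->
  (forall i, exists m, Q i m) -> exists m, forall i, Q i m.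
Proof.
move=> Qle /choice[f fP]; exists (\max_i f i) => i.
by apply: Qle (fP i); apply: leq_bigmax.
Qed.

(** * Eventual monotonicity produces a trapped vertex *)

Section Monotone.
Variables (V : finType) (e : rel V) (N : nat).
Hypothesis Ggraph : connected_simple_graph e.
Implicit Types (x : nat -> config V N) (u v : V) (n m : nat).

(** Once all edges have settled, any edge that is crossed has a divergent crossing number whose sign
    is the direction of the crossing. The vertex left at the settling time [m] serves as [v]: the
    edge used there makes its outflow unbounded. *)
Lemma monotone_trapped x : (forall n, legit e x n) ->
  (exists m, forall u v, e u v ->
    monotone_seq (fun n => crossing x (m + n) u v)) ->
  exists v m, (forall n, (m <= n)%N -> good e v x n) /\
    (forall L, exists2 n, (m <= n)%N & (L <= outflow e x n v)%N).
Proof.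
move=> leg [m0 mono].
(* Finitely many edges, so a common settling time exists. *)
have [m settled] : exists m, forall p : V * V, e p.1 p.2 ->
    settled_from (fun n => crossing x n p.1 p.2) m.
  apply: eventually_forall_fin.
    by move=> p m m' mm' st /st; apply: settled_from_leq.
  move=> p; have [ep|nep] := boolP (e p.1 p.2); last by exists 0%N.
  have [m' st] := monotone_settled (c := fun n => crossing x n p.1 p.2) (mono _ _ ep).
  by exists m'.
(* A single change after [m] excludes two of the three alternatives of [settled_from]: constancy and
   divergence in the opposite direction. *)
have nondec u w n : e u w -> (m <= n)%N ->
    crossing x n.+1 u w = crossing x n u w + 1 ->
    increasing_from (fun k => crossing x k u w) m.
  move=> euw mn step; case: (settled (u, w) euw) => //= [cst|[_ dec _]].
    have := cst n mn; have := cst n.+1; lia.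
  have := dec n n.+1; lia.
have noninc u w n : e u w -> (m <= n)%N ->
    crossing x n.+1 u w = crossing x n u w - 1 ->
    increasing_from (fun k => - crossing x k u w) m.
  move=> euw mn step; case: (settled (u, w) euw) => //= [cst|[_ dec _]].
    have := cst n mn; have := cst n.+1; lia.
  have := dec n n.+1; lia.
have depart n i u : e (x n i) u -> x n.+1 i = u ->
    (forall j, j != i -> x n.+1 j = x n j) ->
    crossing x n.+1 (x n i) u = crossing x n (x n i) u + 1.
  move=> eiu xi xj; have iu := edge_neq Ggraph eiu.
  rewrite (crossing_legit iu xi xj) eqxx xpair_eqE (negbTE iu)/=; lia.
have enter n i u : e (x n i) u -> x n.+1 i = u ->
    (forall j, j != i -> x n.+1 j = x n j) ->
    crossing x n.+1 u (x n i) = crossing x n u (x n i) - 1.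
  move=> eiu xi xj; have iu := edge_neq Ggraph eiu.
  rewrite (crossing_legit _ xi xj) 1?eq_sym// eqxx xpair_eqE (negbTE iu)/=; lia.
have [i [u [evu xi xj]]] := leg m.
set v := x m i in evu.
have up := nondec _ _ _ evu (leqnn m) (depart _ _ _ evu xi xj).
have flow n : - N%:Z <= netflow e x n v <= N%:Z by apply: netflow_bound.
have [w evw down] : exists2 w, e v w &
    increasing_from (fun k => - crossing x k v w) m.
  apply: contrapT => nodown.
  (* Without a descending edge, the edges other than [u] contribute at least [B] at every later
     time, and the unbounded crossing number towards [u] pushes the net flow above [N]. *)
  pose B : int := \sum_(w | e v w && (w != u)) crossing x m v w.
  have [_ _ unb] := up; have [n mn /= Ln] := unb (N%:Z + 1 - B).
  have : B <= \sum_(w | e v w && (w != u)) crossing x n v w.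
    apply: ler_sum => w /andP[evw _]; case: (settled (v, w) evw) => /= [->|[_ + _]|dn] //.
      by apply.
    by case: nodown; exists w.
  have := flow n; rewrite /netflow (bigD1 u)//=.
  set s : int := \sum_(_ | _) _; move: B s Ln => B s; lia.
exists v, m; split=> [n mn|L].
  split.
    split=> //; exists w => //; have [+ _ _] := down => /(_ n mn) /=; lia.
  have [j [a [eja xj' xk]]] := leg n; exists j, a; split=> // [jv|av].
    have [+ _ _] := nondec _ _ _ eja mn (depart _ _ _ eja xj' xk).
    by rewrite jv; apply.
  have eaj : e a (x n j) by rewrite (graph_sym Ggraph).
  have [+ _ _] := noninc _ _ _ eaj mn (enter _ _ _ eja xj' xk).
  by move=> /(_ n mn) /=; rewrite av; lia.
have [pos _ unb] := up; have [n mn /= Ln] := unb L%:Z; exists n => //.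
rewrite /outflow (bigD1 u)/=; last by rewrite evu pos.
lia.
Qed.

End Monotone.

(** * Weight comparison from the classes of reinforcement functions *)

Section Weights.
Variables (R : realType) (V : finType).
Implicit Types (f : nat -> R) (A : {set V}) (a : V -> nat).

Lemma eventually_small_pos (I : finType) (Q : I -> R -> Prop) :
  (forall i b b', 0 < b' -> b' <= b -> Q i b -> Q i b') ->
  (forall i, exists2 b, 0 < b & Q i b) ->
  exists2 b, 0 < b & forall i, Q i b.
Proof.
move=> Qle Qex.
have /choice[f fP] : forall i, exists b, 0 < b /\ Q i b.
  by move=> i; have [b b0 Qb] := Qex i; exists b.
(* The default value 1 keeps the minimum positive for empty [I] too. *)
have min0 : 0 < \big[Num.min/1]_i f i.
  by apply/bigmin_gtP; split=> // i _; have [] := fP i.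
exists (\big[Num.min/1]_i f i) => // i.
by have [_ Qi] := fP i; apply: (Qle i (f i)) => //; apply: bigmin_le.
Qed.

(** The constants of the class depend on the number of summands; [V] has finitely many subsets, so
    one constant serves all of them. The empty set is excluded because its sum is 0 while [f 0] is
    positive. *)
Lemma Pge_sum_set f : (forall k, 0 < f k) -> class_Pge f ->
  exists2 c, 0 < c & forall A a, A != finset.set0 ->
    c * f (\sum_(u in A) a u)%N <= \sum_(u in A) f (a u).
Proof.
move=> f0 fge; apply: (@eventually_small_pos _ (fun A c => forall a, A != finset.set0 ->
    c * f (\sum_(u in A) a u)%N <= \sum_(u in A) f (a u))).
  move=> A b b' b'0 bb' Qb a An0.
  by apply: le_trans (Qb a An0); apply: ler_wpM2r bb'; apply: ltW.
move=> A; have [->|An0] := eqVneq A finset.set0; first by exists 1 => // a; rewrite eqxx.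
have [|C C0 CP] := fge #|A|; first by rewrite card_gt0.
exists C => // a _; rewrite [leRHS]big_enum_val [X in f X]big_enum_val.
exact: CP (fun j => a (enum_val j)).
Qed.

Lemma Ple_sum_set f : (forall k, 0 < f k) -> class_Ple f ->
  exists2 c, 0 < c & forall A a,
    c * \sum_(u in A) f (a u) <= f (\sum_(u in A) a u)%N.
Proof.
move=> f0 fle; apply: (@eventually_small_pos _ (fun A c => forall a,
    c * \sum_(u in A) f (a u) <= f (\sum_(u in A) a u)%N)).
  move=> A b b' b'0 bb' Qb a.
  apply: le_trans (Qb a); apply: ler_wpM2r bb'.
  by apply: sumr_ge0 => u _; apply: ltW.
(* [C] may be 0, so [C + 1] is inverted instead. *)
move=> A; have [C C0 CP] := fle #|A|; exists (C + 1)^-1 => [|a].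
  by rewrite invr_gt0; lra.
rewrite ler_pdivrMl; last lra.
apply: (@le_trans _ _ (C * f (\sum_(u in A) a u)%N)).
  by rewrite [leLHS]big_enum_val [X in f X]big_enum_val; exact: CP (fun j => a (enum_val j)).
by apply: ler_wpM2r; [apply: ltW|lra].
Qed.

End Weights.

(** With [K] the outflow, [SA] and [SB] the total weights of the positive and of the other edges:
    [a * SA <= W1 K] and [b * W2 inflow <= SB]. Since [K] is the inflow plus a net flow of size at
    most [N], also [W2 K <= C * W2 inflow]. Together [SB] is at least
    [a * b / C * (W2 K / W1 K) * SA]. *)
Lemma reversal_weight_bound (R : realType) (V : finType) (e : rel V) (N : nat)
    (W1 W2 : nat -> R) :
  (forall k, 0 < W1 k) -> (forall k, 0 < W2 k) ->
  class_Ple W1 -> class_Pge W2 ->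
  (exists C : R, forall (M : int) (n : nat),
      - N%:Z <= M <= N%:Z -> 0 <= n%:Z + M ->
      W2 `|(n%:Z + M)%R|%N <= C * W2 n) ->
  exists2 c, 0 < c & forall (x : nat -> config V N) n v, balanced e v x n ->
    (1 + c * (W2 (outflow e x n v) / W1 (outflow e x n v))) *
      \sum_(u | e v u && (0 < crossing x n v u)) weight W1 W2 (crossing x n v u)
    <= \sum_(u | e v u) weight W1 W2 (crossing x n v u).
Proof.
move=> W10 W20 /(@Ple_sum_set _ V _ W10)[a a0 aP].
move=> /(@Pge_sum_set _ V _ W20)[b b0 bP] [C CP].
(* The shift bound at [M = 0], [n = 0] compares [W2 0] with itself. *)
have C0 : 0 < C.
  have := CP 0 0%N; rewrite addr0 oppr_le0 lexx lez_nat => /(_ isT isT).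
  by move/(lt_le_trans (W20 _)); rewrite pmulr_lgt0.
exists (a * b / C) => [|x n v [flow [w evw cw]]].
  by rewrite divr_gt0 // mulr_gt0.
set K := outflow e x n v.
have KE := outflow_inflow e x n v; rewrite -/K in KE.
have W2K : W2 K <= C * W2 (inflow e x n v).
  have := CP _ (inflow e x n v) flow; rewrite -KE; apply; lia.
rewrite [leRHS](bigID (fun u => 0 < crossing x n v u)) /=.
set SA := \sum_(u | e v u && (0 < _)) _.
set SB := \sum_(u | _ && ~~ _) _.
have SAle : a * SA <= W1 K.
  pose A := [set u | e v u && (0 < crossing x n v u)]%SET.
  have inA u : (u \in A) = e v u && (0 < crossing x n v u) by rewrite inE.
  have := aP A (fun u => `|crossing x n v u|%N).
  rewrite [X in _ * X <= _ -> _](eq_bigl _ _ inA) [X in _ <= W1 X -> _](eq_bigl _ _ inA).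
  apply: le_trans; rewrite ler_pM2l//.
  by apply: ler_sum => u /andP[_ cu]; rewrite /weight cu.
have SBge : b * W2 (inflow e x n v) <= SB.
  pose B := [set u | e v u && ~~ (0 < crossing x n v u)]%SET.
  have inB u : (u \in B) = e v u && ~~ (0 < crossing x n v u) by rewrite inE.
  have Bn0 : B != finset.set0 by apply/set0Pn; exists w; rewrite inB evw -leNgt.
  have := bP B (fun u => `|crossing x n v u|%N) Bn0.
  rewrite [X in _ <= X -> _](eq_bigl _ _ inB) [X in _ * W2 X <= _ -> _](eq_bigl _ _ inB).
  move/le_trans; apply.
  by apply: ler_sum => u /andP[_ /negbTE cu]; rewrite /weight cu.
rewrite mulrDl mul1r lerD2l.
have -> : a * b / C * (W2 K / W1 K) * SA = (b / C * W2 K) * (a * SA / W1 K).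
  by ring.
apply: le_trans SBge.
have bCW : 0 <= b / C * W2 K by rewrite mulr_ge0 ?divr_ge0 ?(ltW (W20 _)) ?ltW.
apply: (@le_trans _ _ (b / C * W2 K * 1)).
  by apply: ler_wpM2l => //; rewrite ler_pdivrMr// mul1r.
rewrite mulr1 -mulrA ler_pM2l// ler_pdivrMl//.
Qed.

(** * Real-valued probabilities and partitions by finitely valued maps *)

Section FiniteProbability.
Variables (R : realType) (d : measure_display) (T : measurableType d).
Variable P : probability T R.
Local Notation p A := (fine (P A)).

Lemma prob_fineK A : measurable A -> (p A)%:E = P A.
Proof. by move=> mA; rewrite fineK// fin_num_measure. Qed.

Lemma prob_fine_ge0 A : 0 <= p A.
Proof. exact: fine_ge0. Qed.

Lemma prob_fine_le A B : measurable A -> measurable B -> A `<=` B -> p A <= p B.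
Proof.
by move=> mA mB AB; rewrite -lee_fin !prob_fineK//; apply: le_measure; rewrite ?inE.
Qed.

Lemma prob_partition (F : finType) (f : T -> F) (Q : pred F) A :
  (forall y, measurable [set w | f w = y]) -> measurable A ->
  p (A `&` [set w | Q (f w)]) = \sum_(y | Q y) p (A `&` [set w | f w = y]).
Proof.
move=> mf mA.
have mAf y : measurable (A `&` [set w | f w = y]) by apply: measurableI.
have -> : A `&` [set w | Q (f w)] =
    \bigcup_(y in [set y | Q y]) (A `&` [set w | f w = y]).
  apply/seteqP; split=> [w [Aw Qw]|w [y Qy [Aw /= fy]]]; first by exists (f w).
  by split=> //=; rewrite fy.
apply: EFin_inj; rewrite prob_fineK; last first.
  by apply: fin_bigcup_measurable => //; apply: finite_finset.
rewrite measure_fin_bigcup//; last first.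
- by move=> y z _ _ [w [[_ <-] [_ <-]]].
- exact: finite_finset.
rewrite (fsbigE [seq y <- index_enum F | Q y]); last first.
- by move=> y Qy; rewrite mem_filter Qy mem_index_enum.
- by move=> y /=; rewrite mem_filter => /andP[].
- by rewrite filter_uniq// index_enum_uniq.
rewrite big_filter_cond -sumEFin; apply: eq_big => [y|y _]; last first.
  by rewrite prob_fineK.
by rewrite mem_setE andbb.
Qed.

Lemma prob_total (F : finType) (f : T -> F) A :
  (forall y, measurable [set w | f w = y]) -> measurable A ->
  p A = \sum_y p (A `&` [set w | f w = y]).
Proof.
move=> mf mA; rewrite -(prob_partition predT mf mA); congr (p _).
by apply/seteqP; split=> [w ?|w []].
Qed.

End FiniteProbability.

Lemma partial_sums_unbounded (R : realType) (a : nat -> R) (B : R) :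
  (forall k, 0 <= a k) -> (\sum_(0 <= k <oo) (a k)%:E = +oo)%E ->
  exists n, B <= \sum_(0 <= k < n) a k.
Proof.
move=> a0 aoo; apply: contrapT => noB.
suff : (\sum_(0 <= k <oo) (a k)%:E <= B%:E)%E by rewrite aoo leye_eq.
apply: lime_le; first by apply: is_cvg_nneseries => n _ _; rewrite lee_fin.
apply: nearW => n; rewrite sumEFin lee_fin.
by case: (leP B (\sum_(0 <= k < n) a k)) => [Bn|/ltW//]; case: noB; exists n.
Qed.

(** A circuit supplies two distinct vertices, hence one different from [v]; a path to it starts with
    a neighbour of [v]. *)
Lemma vertex_has_neighbour (V : finType) (e : rel V) :
  connected_simple_graph e -> has_circuit e -> forall v, exists u, e v u.
Proof.
move=> Gg [[|a [|b q]]] // _ /andP[_ /= /andP[ab _]] v.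
wlog [c vc] : / exists c, v != c.
  apply; have [va|] := eqVneq v a; last by exists a.
  by exists b; rewrite va /=; apply: contraTneq ab => ->; rewrite inE eqxx.
have /connectP[[|u r] /= + cE] := graph_connected Gg v c.
  by rewrite cE eqxx in vc.
by case/andP=> evu _; exists u.
Qed.

(** * Conditioning on pasts; almost surely one walker moves along an edge *)

Section Walk.
Variables (R : realType) (V : finType) (e : rel V) (N : nat).
Variables (W1 W2 : nat -> R) (d : measure_display) (T : measurableType d).
Variables (P : probability T R).
Variables (X : nat -> T -> config V N) (S : nat -> T -> 'I_N).
Hypothesis Ggraph : connected_simple_graph e.
Hypothesis W1_gt0 : forall k, 0 < W1 k.
Hypothesis W2_gt0 : forall k, 0 < W2 k.
Hypothesis XS_arw : ant_random_walk e W1 W2 P X S.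
Local Notation p A := (fine (P A)).
Local Notation wt := (weight W1 W2).
Implicit Types (x : nat -> config V N) (y : config V N) (n : nat) (v : V).

Lemma weight_gt0 k : 0 < wt k.
Proof. by rewrite /weight; case: ifP. Qed.

(** Entries after [n.+1] are left as in [x]; the past up to [n.+1] does not see them. *)
Definition extend x n y m : config V N := if m == n.+1 then y else x m.

Lemma extend_last x n y : extend x n y n.+1 = y.
Proof. by rewrite /extend eqxx. Qed.

Lemma extend_past x n y m : (m <= n)%N -> extend x n y m = x m.
Proof. by rewrite /extend; case: eqP => // ->; rewrite ltnn. Qed.

Lemma past_extend x n y :
  past X n.+1 (extend x n y) = past X n x `&` [set w | X n.+1 w = y].
Proof.
apply/seteqP; split=> w.
  move=> pw; split=> [m mn|/=]; last by rewrite pw// extend_last.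
  by rewrite pw ?extend_past//; lia.
move=> [pw /= yw] m; rewrite leq_eqVlt => /predU1P[->|mn].
  by rewrite extend_last.
by rewrite extend_past// pw.
Qed.

Lemma measurable_past n x : measurable (past X n x).
Proof.
have -> : past X n x = \bigcap_(m in [set m | (m <= n)%N]) [set w | X m w = x m].
  by apply/seteqP; split.
by apply: bigcap_measurableType => m _; apply: arw_measurable_pos XS_arw _ _.
Qed.

Definition path_upto n (w : T) : {ffun 'I_n.+1 -> config V N} :=
  [ffun k : 'I_n.+1 => X k w].

Lemma path_uptoE n s : [set w | path_upto n w = s] =
  past X n (fun m => s (inord m)).
Proof.
apply/seteqP; split=> w /= => [<- m mn|pw].
  by rewrite ffunE inordK.
by apply/ffunP => k; rewrite ffunE pw ?inord_val// -ltnS.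
Qed.

Lemma measurable_path_upto n s : measurable [set w | path_upto n w = s].
Proof. by rewrite path_uptoE; apply: measurable_past. Qed.

(** There are finitely many histories up to time [n], so an event determined by the history is a
    finite union of past events. *)
Lemma measurable_adapted (Q : (nat -> config V N) -> Prop) n :
  (forall x x', (forall m, (m <= n)%N -> x m = x' m) -> Q x -> Q x') ->
  measurable [set w | Q (X ^~ w)].
Proof.
move=> Qad.
have -> : [set w | Q (X ^~ w)] = \bigcup_(s in
    [set s : {ffun 'I_n.+1 -> config V N} | Q (fun m => s (inord m))])
    [set w | path_upto n w = s].
  apply/seteqP; split=> w /= => [Qw|[s /= Qs]].
    exists (path_upto n w) => //=; apply: Qad Qw => m mn.
    by rewrite ffunE inordK.
  rewrite -[path_upto n w = s]/([set w | path_upto n w = s] w) path_uptoE => pw.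
  by apply: Qad Qs => m mn; rewrite pw.
apply: fin_bigcup_measurable => [|s _]; first exact: finite_finset.
exact: measurable_path_upto.
Qed.

Lemma prob_past_eq0 n A : measurable A ->
  (forall x, p (past X n x `&` A) = 0) -> P A = 0%E.
Proof.
move=> mA A0; rewrite -prob_fineK//.
rewrite (prob_total P (measurable_path_upto (n := n)) mA) big1// => s _.
by rewrite path_uptoE setIC A0.
Qed.

Definition selects n x i := past X n x `&` [set w | S n.+1 w = i].

Lemma measurable_selects n x i : measurable (selects n x i).
Proof.
apply: measurableI; first exact: measurable_past.
exact: arw_measurable_sel XS_arw _ _.
Qed.

Lemma measurable_position n i u : measurable [set w | X n w i = u].
Proof.
apply: (measurable_adapted (Q := fun x => x n i = u) (n := n)).
by move=> x x' xx' <-; rewrite xx'.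
Qed.

Lemma prob_selects_stay0 n x i y j : j != i -> y j != x n j ->
  p (selects n x i `&` [set w | X n.+1 w = y]) = 0.
Proof.
move=> ji yj; have mA : measurable (selects n x i `&` [set w | X n.+1 w = y]).
  by apply: measurableI; [exact: measurable_selects|exact: arw_measurable_pos XS_arw _ _].
rewrite (measure_negligible mA)//.
apply: negligibleS (arw_stay XS_arw n) => w [[pw /= Sw] yw] /= /(_ j).
rewrite Sw => /(_ ji); rewrite yw pw// => yjE.
by rewrite yjE eqxx in yj.
Qed.

(** Sums [arw_move] over the targets in [Q]; they have to be neighbours, as [arw_move] speaks of no
    other targets. *)
Lemma prob_selects_move n x i (Q : pred V) : (exists u, e (x n i) u) ->
  (forall u, Q u -> e (x n i) u) ->
  p (selects n x i `&` [set w | Q (X n.+1 w i)]) =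
  (\sum_(u | Q u) wt (crossing x n (x n i) u)) /
  (\sum_(u | e (x n i) u) wt (crossing x n (x n i) u)) * p (selects n x i).
Proof.
move=> [u0 eu0] Qe.
rewrite (prob_partition P (f := fun w => X n.+1 w i)); last 2 first.
- by move=> u; apply: measurable_position.
- exact: measurable_selects.
rewrite mulr_suml mulr_suml; apply: eq_bigr => u Qu.
rewrite (arw_move XS_arw (Qe u Qu)) -/(selects n x i).
by rewrite -(prob_fineK P (measurable_selects n x i)) -EFinM.
Qed.

Lemma sum_weight_gt0 x n v : (exists u, e v u) ->
  0 < \sum_(u | e v u) wt (crossing x n v u).
Proof.
move=> [u eu]; rewrite (bigD1 u)//= ltr_pwDl ?weight_gt0//.
by apply: sumr_ge0 => w _; apply/ltW/weight_gt0.
Qed.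

Lemma measurable_illegit n : measurable [set w | ~ legit e (X ^~ w) n].
Proof.
apply: (measurable_adapted (Q := fun x => ~ legit e x n) (n := n.+1)).
move=> x x' xx' nl [i [u l]]; apply: nl; exists i, u.
by rewrite (xx' n)// (xx' n.+1).
Qed.

(** The transition probabilities to the neighbours of a vertex that has some add up to 1, so nothing
    is left for a jump to a non-neighbour. Any other illegal step moves an unselected walker, which
    [arw_stay] rules out almost surely. *)
Lemma prob_illegit n : (forall v, exists u, e v u) ->
  P [set w | ~ legit e (X ^~ w) n] = 0%E.
Proof.
move=> nbr.
have mL := measurable_illegit n.
apply: (@prob_past_eq0 n) => // x.
have mpL : measurable (past X n x `&` [set w | ~ legit e (X ^~ w) n]).
  by apply: measurableI => //; apply: measurable_past.
rewrite (prob_total P (f := S n.+1))//; last exact: arw_measurable_sel XS_arw _.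
apply: big1 => i _.
have mS : measurable [set w | S n.+1 w = i] by exact: arw_measurable_sel XS_arw _ _.
rewrite (measure_negligible (measurableI _ _ mpL mS))//.
pose E := selects n x i `&` [set w | predC (e (x n i)) (X n.+1 w i)].
have mE : measurable E.
  apply: measurableI; first exact: measurable_selects.
  apply: (measurable_adapted (Q := fun x' => predC (e (x n i)) (x' n.+1 i)) (n := n.+1)).
  by move=> x1 x2 /= ->.
have E0 : P.-negligible E.
  suff pE0 : p E = 0.
    by apply/negligibleP => //; apply: etrans (esym (prob_fineK P mE)) _; rewrite pE0.
  (* The first summand already carries the whole mass of [selects n x i]. *)
  have : p (selects n x i) = p (selects n x i `&` [set w | e (x n i) (X n.+1 w i)]) + p E.
    rewrite /E !(prob_partition P (f := fun w => X n.+1 w i)); try exact: measurable_selects;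
      try by move=> u; apply: measurable_position.
    rewrite (prob_total P (f := fun w => X n.+1 w i) (A := selects n x i)); last 2 first.
    - by move=> u; apply: measurable_position.
    - exact: measurable_selects.
    by rewrite (bigID (e (x n i))).
  rewrite (prob_selects_move (nbr _))// divff ?gt_eqF ?sum_weight_gt0// mul1r => h.
  lra.
apply: negligibleS (negligibleU E0 (arw_stay XS_arw n)) => w [[pw nl] Sw].
have [st|nst] := pselect (forall j, j != S n.+1 w -> X n.+1 w j = X n w j); last by right.
left; split=> //=; apply/negP => eu; apply: nl; exists i, (X n.+1 w i).
by rewrite pw//; split=> // j ji; rewrite st ?pw// Sw.
Qed.

(** * A supermartingale in the outflow, killed when monotonicity is violated *)

Variable c : R.
Hypothesis c_gt0 : 0 < c.
Hypothesis reversal : forall x n v, balanced e v x n ->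
  (1 + c * (W2 (outflow e x n v) / W1 (outflow e x n v))) *
    \sum_(u | e v u && (0 < crossing x n v u)) wt (crossing x n v u)
  <= \sum_(u | e v u) wt (crossing x n v u).

(* A linearised product of the factors [1 + c * (W2 k / W1 k)]: it grows by at
   most that factor because it is at least 1. *)
Definition potential k : R := 1 + c * \sum_(0 <= j < k) W2 j / W1 j.

Lemma ratio_ge0 k : 0 <= W2 k / W1 k.
Proof. by rewrite divr_ge0// ltW. Qed.

Lemma potential_ge1 k : 1 <= potential k.
Proof.
rewrite lerDl mulr_ge0 ?(ltW c_gt0)//; apply: sumr_ge0 => j _; exact: ratio_ge0.
Qed.

Lemma potential_gt0 k : 0 < potential k.
Proof. exact: lt_le_trans ltr01 (potential_ge1 k). Qed.

Lemma potentialS k :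
  potential k <= potential k.+1 <= (1 + c * (W2 k / W1 k)) * potential k.
Proof.
have cr : 0 <= c * (W2 k / W1 k) by rewrite mulr_ge0 ?ratio_ge0 ?(ltW c_gt0).
have -> : potential k.+1 = potential k + c * (W2 k / W1 k).
  by rewrite /potential big_nat_recr//=; ring.
rewrite lerDl cr mulrDl mul1r lerD2l /= ler_peMr// potential_ge1//.
Qed.

Lemma potential_le k l : (k <= l)%N -> potential k <= potential l.
Proof.
move=> kl; rewrite -(subnKC kl); elim: (l - k)%N => [|m IH]; rewrite ?addn0//.
by rewrite addnS; apply: le_trans IH _; case/andP: (potentialS (k + m)).
Qed.

Lemma good_extend v x n y i : good e v (extend x n y) n ->
  (forall j, j != i -> y j = x n j) ->
  (* The walker moved in [good] must be [i]: any other stays put, and there are no loops. *)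
  [/\ e (x n i) (y i), x n i = v -> 0 < crossing x n v (y i) &
    outflow e (extend x n y) n.+1 v = (outflow e x n v + (x n i == v))%N].
Proof.
move=> [_ [i' [u []]]] eu xi xj dep ent yj.
have step := outflow_step Ggraph eu xi xj dep ent.
move: eu xi dep step.
rewrite (crossing_eq (y := x)); last by move=> m; apply: extend_past.
rewrite extend_last extend_past// => eu xi dep.
have ii' : i' = i.
  apply/eqP; apply: contraTT eu => /yj; rewrite -xi => ->.
  by rewrite (graph_irrefl Ggraph).
rewrite -{}ii' xi => ->; split=> //; congr (_ + _)%N.
by apply: outflow_eq => m; apply: extend_past.
Qed.

(** If walker [i] is not at [v], the outflow [K] is unchanged along good steps. If it is at [v], [K]
    becomes [K.+1]; the potential grows by a factor of at most [1 + c * (W2 K / W1 K)], and by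
    [reversal] the probability of a good departure is at most the inverse of this factor. *)
Lemma potential_drift_select v x n i : balanced e v x n ->
  \sum_(y | `[< good e v (extend x n y) n >])
    p (selects n x i `&` [set w | X n.+1 w = y]) *
    potential (outflow e (extend x n y) n.+1 v)
  <= p (selects n x i) * potential (outflow e x n v).
Proof.
move=> bal; set K := outflow e x n v; set A := selects n x i.
have mA : measurable A by apply: measurable_selects.
have mX y : measurable [set w | X n.+1 w = y] by apply: arw_measurable_pos XS_arw _ _.
have pK0 : 0 <= potential K by apply/ltW/potential_gt0.
have nullP y : p (A `&` [set w | X n.+1 w = y]) = 0 \/
    forall j, j != i -> y j = x n j.
  have [?|/existsNP[j /not_implyP[ji /eqP yj]]] :=
    pselect (forall j, j != i -> y j = x n j); first by right.
  by left; apply: (prob_selects_stay0 ji).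
have [iv|iv] := eqVneq (x n i) v.
  pose Q u := e v u && (0 < crossing x n v u).
  (* Enlarging the sum to all [y] whose [i]-th walker takes a positive edge turns it into one
     transition probability times a constant. *)
  pose B : R := \sum_(y : config V N | Q (y i))
    p (A `&` [set w | X n.+1 w = y]) * potential K.+1.
  apply: (@le_trans _ _ B); rewrite /B.
    rewrite [leLHS]big_mkcond [leRHS]big_mkcond/=; apply: ler_sum => y _.
    case: asboolP => gd; last first.
      by case: ifP => // _; rewrite mulr_ge0 ?prob_fine_ge0// ltW// potential_gt0.
    have [->|yj] := nullP y; first by rewrite !mul0r if_same.
    have [ey cy ->] := good_extend gd yj.
    have -> : Q (y i) by rewrite /Q cy// andbT -{1}iv.
    by rewrite iv eqxx addn1.
  rewrite -mulr_suml -(prob_partition P (fun y : config V N => Q (y i)) mX mA).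
  have [w0 ew0 _] := bal.2.
  have /prob_selects_move : exists u, e (x n i) u by exists w0; rewrite iv.
  move=> /(_ Q) ->; last by move=> u /andP[]; rewrite iv.
  rewrite iv -/A mulrAC mulrC; apply: ler_wpM2l; first exact: prob_fine_ge0.
  rewrite mulrAC ler_pdivrMr; last by apply: sum_weight_gt0; exists w0.
  have SA0 : 0 <= \sum_(u | Q u) wt (crossing x n v u).
    by apply: sumr_ge0 => u _; apply/ltW/weight_gt0.
  have /andP[_ hS] := potentialS K.
  apply: (le_trans (ler_wpM2l SA0 hS)).
  by rewrite mulrCA mulrA mulrC; apply: ler_wpM2l => //; apply: reversal.
rewrite [X in _ <= X * _](prob_total P mX mA) mulr_suml big_mkcond/=.
apply: ler_sum => y _; case: asboolP => gd; last first.
  by rewrite mulr_ge0// prob_fine_ge0.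
have [->|yj] := nullP y; first by rewrite !mul0r.
by have [_ _ ->] := good_extend gd yj; rewrite (negbTE iv) addn0.
Qed.

(** Sums the previous bound over the selected index. From an unbalanced past no extension is good,
    so the left side is empty. *)
Lemma potential_drift v x n :
  \sum_(y | `[< good e v (extend x n y) n >])
    p (past X n.+1 (extend x n y)) *
    potential (outflow e (extend x n y) n.+1 v)
  <= p (past X n x) * potential (outflow e x n v).
Proof.
have [bal|nbal] := pselect (balanced e v x n); last first.
  rewrite big_pred0 => [|y].
    by rewrite mulr_ge0 ?prob_fine_ge0// ltW// potential_gt0.
  apply/asboolP => -[+ _] => /(balanced_eq (y := x)) b; apply: nbal; apply: b.
  by move=> m; apply: extend_past.
have mS i : measurable [set w | S n.+1 w = i] by apply: arw_measurable_sel XS_arw _ _.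
have mp := measurable_past n x.
rewrite (prob_total P mS mp) mulr_suml.
apply: le_trans (ler_sum _ (fun i _ => potential_drift_select i bal)).
rewrite exchange_big /=; apply: ler_sum => y _.
rewrite -mulr_suml ler_wpM2r//; first by apply/ltW/potential_gt0.
rewrite (prob_total P mS (measurable_past _ _)).
by apply: ler_sum => i _; rewrite past_extend setIAC.
Qed.

Lemma measurable_past_good v L r x n : measurable (past X n x `&` [set w |
    (forall k, (n <= k < n + r)%N -> good e v (X ^~ w) k) /\
    (L <= outflow e (X ^~ w) (n + r) v)%N]).
Proof.
apply: measurableI; first exact: measurable_past.
apply: (measurable_adapted (Q := fun x =>
  (forall k, (n <= k < n + r)%N -> good e v x k) /\
  (L <= outflow e x (n + r) v)%N) (n := (n + r)%N)) => x1 x2 x12 [gd LK].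
split=> [k nk|]; last by rewrite -(outflow_eq e v x12).
by apply: good_eq (gd k nk) => m mk; apply: x12; lia.
Qed.

(** Maximal-type bound at horizon [r], by induction on [r] through the first step: the drift bound
    absorbs one good step, and for [r = 0] monotonicity of [potential] suffices. *)
Lemma prob_good_outflow v L r x n :
  p (past X n x `&` [set w |
      (forall k, (n <= k < n + r)%N -> good e v (X ^~ w) k) /\
      (L <= outflow e (X ^~ w) (n + r) v)%N]) * potential L
  <= p (past X n x) * potential (outflow e x n v).
Proof.
elim: r x n => [|r IH] x n.
  have [LK|KL] := leqP L (outflow e x n v).
    apply: ler_pM; rewrite ?prob_fine_ge0 ?(ltW (potential_gt0 _)) ?potential_le//.
    apply: prob_fine_le; [exact: measurable_past_good|exact: measurable_past|].
    exact: subIsetl.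
  set E := _ `&` _; have -> : E = set0.
    apply/seteqP; split=> // w [pw [_ /=]]; rewrite addn0.
    by rewrite (outflow_eq _ _ pw) leqNgt KL.
  by rewrite measure0 mul0r mulr_ge0 ?prob_fine_ge0// ltW// potential_gt0.
set E := [set w | _].
have mX y : measurable [set w | X n.+1 w = y] by apply: arw_measurable_pos XS_arw _ _.
rewrite (prob_total P mX (measurable_past_good _ _ _ _ _)) mulr_suml.
apply: le_trans (potential_drift v x n).
rewrite [leRHS]big_mkcond/=; apply: ler_sum => y _.
rewrite setIAC -past_extend.
have Egood w : (past X n.+1 (extend x n y) `&` E) w -> good e v (extend x n y) n.
  move=> [pw [gd _]]; apply: (good_eq (x := X ^~ w)); last by apply: gd; lia.
  exact: pw.
case: asboolP => [_|ngd]; last first.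
  set F := _ `&` _; have -> : F = set0; last by rewrite measure0 mul0r.
  by apply/seteqP; split=> // w /Egood.
apply: le_trans (IH (extend x n y) n.+1); rewrite ler_wpM2r ?(ltW (potential_gt0 _))//.
apply: prob_fine_le; try exact: measurable_past_good.
  by rewrite past_extend setIAC; apply: measurableI => //; apply: measurable_past_good.
move=> w [pw [gd LK]]; split=> //; split=> [k /andP[nk kr]|]; last by rewrite addSnnS.
by apply: gd; lia.
Qed.

(** * A vertex is trapped with probability zero *)

Definition trapped v m : set T := [set w |
  (forall k, (m <= k)%N -> good e v (X ^~ w) k) /\
  (forall L, exists2 k, (m <= k)%N & (L <= outflow e (X ^~ w) k v)%N)].

Lemma measurable_good v k : measurable [set w | good e v (X ^~ w) k].
Proof.
apply: (measurable_adapted (Q := fun x => good e v x k) (n := k.+1)) => x x'.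
exact: good_eq.
Qed.

Lemma measurable_outflow v k L : measurable [set w | (L <= outflow e (X ^~ w) k v)%N].
Proof.
apply: (measurable_adapted (Q := fun x => (L <= outflow e x k v)%N) (n := k)).
by move=> x x' /outflow_eq ->.
Qed.

Lemma measurable_trapped v m : measurable (trapped v m).
Proof.
have -> : trapped v m =
    (\bigcap_(k in [set k | (m <= k)%N]) [set w | good e v (X ^~ w) k]) `&`
    (\bigcap_L \bigcup_(k in [set k | (m <= k)%N])
      [set w | (L <= outflow e (X ^~ w) k v)%N]).
  apply/seteqP; split=> w [gd unb]; split=> // L.
    by move=> _; have [k mk Lk] := unb L; exists k.
  by have [k mk Lk] := unb L I; exists k.
apply: measurableI.
  by apply: bigcap_measurableType => k _; apply: measurable_good.
apply: bigcap_measurableType => L _.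
by apply: bigcup_measurable => k _; apply: measurable_outflow.
Qed.

Lemma trapped_outflow_le v m w k l : trapped v m w -> (m <= k <= l)%N ->
  (outflow e (X ^~ w) k v <= outflow e (X ^~ w) l v)%N.
Proof.
move=> [gd _] /andP[mk kl]; rewrite -(subnKC kl).
elim: (l - k)%N => [|r IH]; rewrite ?addn0// addnS; apply: leq_trans IH _.
by apply: (good_outflow_le Ggraph); apply: gd; lia.
Qed.

(** On [trapped v m] the outflow never decreases after [m], so the events [F r] increase to the
    whole event; continuity from below carries the bound, uniform in the horizon, to the limit. *)
Lemma prob_trapped_le v m x L :
  p (past X m x `&` trapped v m) * potential L
  <= p (past X m x) * potential (outflow e x m v).
Proof.
pose F r := past X m x `&` trapped v m `&`
  [set w | (L <= outflow e (X ^~ w) (m + r) v)%N].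
have mA : measurable (past X m x `&` trapped v m).
  by apply: measurableI; [exact: measurable_past|exact: measurable_trapped].
have mF r : measurable (F r) by apply: measurableI => //; exact: measurable_outflow.
have Fcup : \bigcup_r F r = past X m x `&` trapped v m.
  apply/seteqP; split=> [w [r _ []]//|w [pw tw]].
  by have [k mk Lk] := tw.2 L; exists (k - m)%N => //; split=> //=; rewrite subnKC.
have Fhomo : {homo F : r s / (r <= s)%N >-> (r <= s)%O}.
  move=> r s rs; apply/subsetPset => w [[pw tw] Lr]; split=> //=.
  apply: leq_trans Lr _; apply: (trapped_outflow_le tw); lia.
rewrite -ler_pdivlMr ?potential_gt0// -lee_fin prob_fineK// -Fcup.
have mcup : measurable (\bigcup_r F r) by rewrite Fcup.
have cvgF := nondecreasing_cvg_mu (mu := P) mF mcup Fhomo.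
rewrite -(cvg_lim _ cvgF)//; apply: lime_le; first by apply/cvg_ex; eexists; exact: cvgF.
apply: nearW => r /=; rewrite -prob_fineK// lee_fin ler_pdivlMr ?potential_gt0//.
apply: le_trans (prob_good_outflow v L r x m).
rewrite ler_wpM2r ?(ltW (potential_gt0 _))//.
apply: prob_fine_le => //; first exact: measurable_past_good.
by move=> w [[pw tw] Lr]; split=> //; split=> // k /andP[mk _]; apply: tw.1.
Qed.

Hypothesis ratio_sum : (\sum_(0 <= k <oo) (W2 k / W1 k)%:E = +oo)%E.

Lemma potential_unbounded B : exists L, B <= potential L.
Proof.
have [L BL] := partial_sums_unbounded (B / c) ratio_ge0 ratio_sum.
exists L; rewrite /potential; apply: (@le_trans _ _ (c * (B / c))).
  by rewrite mulrCA divff ?gt_eqF// mulr1.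
by rewrite -[leLHS]add0r lerD// ler_wpM2l// ltW.
Qed.

Lemma prob_trapped v m : P (trapped v m) = 0%E.
Proof.
apply: (@prob_past_eq0 m); first exact: measurable_trapped.
move=> x; set q := p _; apply/eqP; rewrite eq_le prob_fine_ge0 andbT leNgt.
apply/negP => q0.
(* This [L] makes [q * potential L] exceed the bound of [prob_trapped_le] by at least 1. *)
have [L BL] := potential_unbounded ((p (past X m x) * potential (outflow e x m v) + 1) / q).
have := prob_trapped_le v m x L; rewrite -/q => le1.
have := ler_wpM2l (ltW q0) BL; rewrite mulrCA divff ?gt_eqF// mulr1 => le2.
by have := le_trans le2 le1; rewrite gerDl ler10.
Qed.

End Walk.

(** * Measurability of the monotonicity event, and the conclusion *)

Lemma measurable_Monot (R : realType) (V : finType) (e : rel V) (N : nat)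
    (W1 W2 : nat -> R) (d : measure_display) (T : measurableType d)
    (P : probability T R) (X : nat -> T -> config V N) (S : nat -> T -> 'I_N) :
  ant_random_walk e W1 W2 P X S -> measurable (Monot e X).
Proof.
move=> XS_arw.
have mle a b u v :
    measurable [set w | crossing (X ^~ w) a u v <= crossing (X ^~ w) b u v].
  apply: (measurable_adapted XS_arw
    (Q := fun x => crossing x a u v <= crossing x b u v) (n := maxn a b)).
  move=> x x' xx'.
  rewrite (crossing_eq (x := x) (y := x') (n := a)); last by move=> m ma; apply: xx'; lia.
  by rewrite (crossing_eq (x := x) (y := x') (n := b)) // => m mb; apply: xx'; lia.
(* Monotonicity is a countable combination of comparisons between two crossing numbers. *)
have -> : Monot e X = \bigcup_m \bigcap_(q in [set q : V * V | e q.1 q.2])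
    ((\bigcap_a \bigcap_(b in [set b | (a <= b)%N]) [set w |
        crossing (X ^~ w) (m + a) q.1 q.2 <= crossing (X ^~ w) (m + b) q.1 q.2]) `|`
     (\bigcap_a \bigcap_(b in [set b | (a <= b)%N]) [set w |
        crossing (X ^~ w) (m + b) q.1 q.2 <= crossing (X ^~ w) (m + a) q.1 q.2])).
  apply/seteqP; split=> w.
    move=> [m mono]; exists m => // -[u v] /= /mono[inc|dec]; [left|right].
      by move=> a _ b /= ab; apply: inc.
    by move=> a _ b /= ab; apply: dec.
  move=> [m _ mono]; exists m => u v euv.
  have [inc|dec] := mono (u, v) euv; [left|right] => a b ab.
    exact: inc ab.
  exact: dec ab.
apply: bigcup_measurable => m _; apply: fin_bigcap_measurable.
  exact: finite_finset.
by move=> q _; apply: measurableU; do 2 (apply: bigcap_measurableType => ? _).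
Qed.

Theorem theorem4p1 (R : realType) (V : finType) (e : rel V) (N : nat)
    (W1 W2 : nat -> R)
    (d : measure_display) (T : measurableType d) (P : probability T R)
    (X : nat -> T -> config V N) (S : nat -> T -> 'I_N)
    (Ggraph : connected_simple_graph e) (Gcircuit : has_circuit e)
    (N_ge1 : (1 <= N)%N)
    (W1_gt0 : forall k, 0 < W1 k) (W2_gt0 : forall k, 0 < W2 k)
    (XS_arw : ant_random_walk e W1 W2 P X S)
    (W1_Ple : class_Ple W1) (W2_Pge : class_Pge W2)
    (W2_shift : exists C : R, forall (M : int) (n : nat),
      - N%:Z <= M <= N%:Z -> 0 <= n%:Z + M ->
      W2 `|(n%:Z + M)%R|%N <= C * W2 n)
    (W_sum : (\sum_(0 <= k <oo) (W2 k / W1 k)%:E = +oo)%E) :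
  P (Monot e X) = 0%E.
Proof.
have [c c_gt0 reversal] :=
  @reversal_weight_bound R V e N W1 W2 W1_gt0 W2_gt0 W1_Ple W2_Pge W2_shift.
have nbr := vertex_has_neighbour Ggraph Gcircuit.
apply: measure_negligible; first exact: measurable_Monot XS_arw.
have ill0 : P.-negligible (\bigcup_n [set w | ~ legit e (X ^~ w) n]).
  apply: negligible_bigcup => n; apply/negligibleP.
    exact: (measurable_illegit XS_arw).
  exact: (prob_illegit W1_gt0 W2_gt0 XS_arw).
(* The pairs of a vertex and a time are countable; they are enumerated by [unpickle], and a number
   coding no pair gives the empty set. *)
have trapped0 : P.-negligible (\bigcup_k
    oapp (fun q : V * nat => trapped e X q.1 q.2) set0 (unpickle k)).
  apply: negligible_bigcup => k; case: (unpickle k) => [[v m]|] /=.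
    apply/negligibleP; first exact: (measurable_trapped XS_arw).
    exact: (prob_trapped Ggraph W1_gt0 W2_gt0 XS_arw c_gt0 reversal).
  exact: negligible_set0.
apply: negligibleS (negligibleU ill0 trapped0) => w monow.
have [leg|/existsNP[n nleg]] := pselect (forall n, legit e (X ^~ w) n); last first.
  by left; exists n.
have [v [m trap]] := monotone_trapped Ggraph leg monow.
by right; exists (pickle (v, m)) => //; rewrite pickleK.
Qed.
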